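(* Let $D,W,V,K$ be positive integers, $N:=W+VK$. Fix $\sharp\in\{\mathrm{st},\mathrm{m}\}$ and index pairs $\theta^{(\sharp)}(1),\dots,\theta^{(\sharp)}(J)$, lying in $\{1,\dots,W\}^{\times2}$ if $\sharp=\mathrm{st}$ and in $\{1,\dots,VK\}^{\times2}$ if $\sharp=\mathrm{m}$. For $P=(P_{\mathrm{st}}\,|\,P_{\mathrm{m}})\in\mathbb{R}^{D\times N}$ with $P_{\mathrm{st}}\in\mathbb{R}^{D\times W}$, let $\mathcal{D}:=P_{\mathrm{st}}^TP_{\mathrm{m}}\in\mathbb{R}^{W\times VK}$ and $\mathcal{M}(P):=\bigl(\mathrm{vec}(\mathcal{N}^{(\sharp)}_1)\,|\cdots|\,\mathrm{vec}(\mathcal{N}^{(\sharp)}_J)\bigr)$ with $$\mathcal{N}^{(\mathrm{st})}_j:=\tfrac12\Bigl(\bigl(\mathcal{D}_{\theta^{(\mathrm{st})}(j)_1,1:D}\bigr)^T\mathcal{D}_{\theta^{(\mathrm{st})}(j)_2,1:D}+\bigl(\mathcal{D}_{\theta^{(\mathrm{st})}(j)_2,1:D}\bigr)^T\mathcal{D}_{\theta^{(\mathrm{st})}(j)_1,1:D}\Bigr),$$ $$\mathcal{N}^{(\mathrm{m})}_j:=\tfrac12\Bigl(\mathcal{D}_{1:D,\theta^{(\mathrm{m})}(j)_1}\bigl(\mathcal{D}_{1:D,\theta^{(\mathrm{m})}(j)_2}\bigr)^T+\mathcal{D}_{1:D,\theta^{(\mathrm{m})}(j)_2}\bigl(\mathcal{D}_{1:D,\theta^{(\mathrm{m})}(j)_1}\bigr)^T\Bigr).$$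 Then either every $P\in\mathbb{R}^{D\times N}$ satisfies $\mathrm{rank}(\mathcal{M}(P))<D(D+1)/2$, or Lebesgue-almost all $P\in\mathbb{R}^{D\times N}$ satisfy $\mathrm{rank}(\mathcal{M}(P))=D(D+1)/2$.
   Context: $\mathcal{D}_{i,1:D}$ is the row vector of the first $D$ entries of row $i$ of $\mathcal{D}$; $\mathcal{D}_{1:D,l}$ is the column vector of the first $D$ entries of column $l$ of $\mathcal{D}$. $\theta(j)_1,\theta(j)_2$ are the two components of the index pair $\theta(j)$. $\mathrm{vec}(X)$ stacks the columns of $X$ into a single column vector. *)

(* Defs.v *)
From HB Require Import structures.
From mathcomp Require Import all_boot all_order all_algebra.
From mathcomp Require Import reals.
Set Implicit Arguments. Unset Strict Implicit. Unset Printing Implicit Defensive.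
Import Order.TTheory GRing.Theory Num.Theory.
Local Open Scope ring_scope.

Inductive sharp := St | Mx.

(* Range of the index pairs: {1..W} for st, {1..VK} for m (0-based here). *)
Definition sharp_bound (s : sharp) (W V K : nat) : nat :=
  match s with St => W | Mx => (V * K)%N end.

Section Defs.
Variable R : realType.

(* First D entries of row i of Dm (zero padding if Dm has fewer columns). *)
Definition row_first (D W VK : nat) (Dm : 'M[R]_(W, VK)) (i : 'I_W) : 'rV[R]_D :=
  \row_(k < D) (match @insub nat (fun x => (x < VK)%N) 'I_VK (val k) with
                | Some c => Dm i c | None => 0 end).

(* First D entries of column l of Dm (zero padding if Dm has fewer rows). *)
Definition col_first (D W VK : nat) (Dm : 'M[R]_(W, VK)) (l : 'I_VK) : 'cV[R]_D :=
  \col_(k < D) (match @insub nat (fun x => (x < W)%N) 'I_W (val k) with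
                | Some r => Dm r l | None => 0 end).

(* vec(X): stack the columns of X into one column vector (column-major). *)
Definition vecc (m n : nat) (X : 'M[R]_(m, n)) : 'cV[R]_(n * m) := (mxvec X^T)^T.

Definition Nmat (D W V K : nat) (s : sharp) (Dm : 'M[R]_(W, V * K))
  : 'I_(sharp_bound s W V K) * 'I_(sharp_bound s W V K) -> 'M[R]_D :=
  match s return 'I_(sharp_bound s W V K) * 'I_(sharp_bound s W V K) -> 'M[R]_D with
  | St => fun p =>
      2^-1 *: ((row_first D Dm p.1)^T *m row_first D Dm p.2
               + (row_first D Dm p.2)^T *m row_first D Dm p.1)
  | Mx => fun p =>
      2^-1 *: (col_first D Dm p.1 *m (col_first D Dm p.2)^T
               + col_first D Dm p.2 *m (col_first D Dm p.1)^T)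
  end.

Definition Mmat (D W V K J : nat) (s : sharp)
  (theta : 'I_J -> 'I_(sharp_bound s W V K) * 'I_(sharp_bound s W V K))
  (P : 'M[R]_(D, W + V * K)) : 'M[R]_(D * D, J) :=
  let Dm := (lsubmx P)^T *m rsubmx P in
  \matrix_(r < D * D, j < J) vecc (@Nmat D W V K s Dm (theta j)) r ord0.

Definition box_vol (m n : nat) (a b : 'M[R]_(m, n)) : R :=
  \prod_(i < m) \prod_(j < n) (b i j - a i j).

Definition lebesgue_null (m n : nat) (A : 'M[R]_(m, n) -> Prop) : Prop :=
  forall eps : R, 0 < eps ->
  exists (a b : nat -> 'M[R]_(m, n)),
    (forall k i j, a k i j <= b k i j) /\
    (forall x, A x -> exists k, forall i j, a k i j <= x i j <= b k i j) /\
    (forall N, \sum_(k < N) box_vol (a k) (b k) <= eps).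

Definition ae_lebesgue (m n : nat) (Q : 'M[R]_(m, n) -> Prop) : Prop :=
  exists Z : 'M[R]_(m, n) -> Prop, lebesgue_null Z /\ forall x, ~ Z x -> Q x.

End Defs.

(* Main.v *)
Require Import Defs.
From HB Require Import structures.
From mathcomp Require Import all_boot all_order all_algebra.
From mathcomp Require Import reals boolp ring lra.
Import Order.TTheory GRing.Theory Num.Theory.
Local Open Scope ring_scope.

Set Implicit Arguments.
Unset Strict Implicit.
Unset Printing Implicit Defensive.

(* The columns of M(P) are vectorised symmetric matrices, so its rank never exceeds
   D(D+1)/2.  If that value is reached at some P0, then some minor of this order is
   nonzero at P0; it is a polynomial in P, and it suffices that the zero set of a
   nonzero polynomial f is null.  This follows by induction on the degree: unless f
   is constant, some partial derivative g of f is a nonzero polynomial of smaller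
   degree, so {g = 0} is null, while {f = 0, g != 0} is a countable union of bounded
   Lipschitz graphs over a coordinate hyperplane, each of which is covered by
   O(N^(d-1)) boxes of volume O(N^-d). *)

(** * Finite sums over lists and a geometric sum *)

Lemma ler_sum_subset (R : numDomainType) (I : eqType) (s t : seq I) (F : I -> R) :
  (forall i, 0 <= F i) -> uniq s -> uniq t -> {subset s <= t} ->
  \sum_(i <- s) F i <= \sum_(i <- t) F i.
Proof.
move=> F0 us ut st.
have ps : perm_eq [seq i <- t | i \in s] s.
  apply: uniq_perm => //; first exact: filter_uniq.
  by move=> i; rewrite mem_filter; have [/st->|] := boolP (i \in s).
by rewrite [leRHS](bigID (mem s)) /= -[X in _ <= X + _]big_filter (perm_big _ ps) lerDl sumr_ge0.
Qed.

Lemma big_pmap (R I J : Type) (idx : R) (op : R -> R -> R) (f : I -> option J)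
    (s : seq I) (F : J -> R) :
  \big[op/idx]_(j <- pmap f s) F j =
  \big[op/idx]_(i <- s | f i) oapp F idx (f i).
Proof.
elim: s => [|i s IHs]; first by rewrite !big_nil.
by rewrite big_cons /=; case: (f i) => [j|] //=; rewrite big_cons IHs.
Qed.

Lemma geometric_sum_le (R : realFieldType) (e : R) (n : nat) :
  0 <= e -> \sum_(k < n) e / 2 ^+ k.+1 <= e.
Proof.
move=> e0; suff -> : \sum_(k < n) e / 2 ^+ k.+1 = e - e / 2 ^+ n.
  by rewrite gerBl divr_ge0 // exprn_ge0.
elim: n => [|n IHn]; first by rewrite big_ord0 expr0 divr1 subrr.
rewrite big_ord_recr /= IHn exprS.
by field; rewrite expf_neq0 //= pnatr_eq0.
Qed.

(** * Null sets *)

Section NullSets.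
Variables (R : realType) (m n : nat).
Implicit Types (A B : 'M[R]_(m, n) -> Prop) (a b x y : 'M[R]_(m, n)).

Lemma box_vol_ge0 a b : (forall i j, a i j <= b i j) -> 0 <= box_vol a b.
Proof.
by move=> ab; apply: prodr_ge0 => i _; apply: prodr_ge0 => j _; rewrite subr_ge0.
Qed.

Lemma box_vol_point a : (0 < m)%N -> (0 < n)%N -> box_vol a a = 0.
Proof.
move=> m0 n0; rewrite /box_vol (bigD1 (Ordinal m0)) //= (bigD1 (Ordinal n0)) //=.
by rewrite subrr !mul0r.
Qed.

Lemma lebesgue_null_sub A B :
  (forall x, A x -> B x) -> lebesgue_null B -> lebesgue_null A.
Proof.
move=> AB nB e /nB[a [b [ab [cB sB]]]]; exists a, b; split=> //; split=> // x Ax.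
exact/cB/AB.
Qed.

Hypotheses (m_gt0 : (0 < m)%N) (n_gt0 : (0 < n)%N).

(** Boxes may be indexed by any countable type: codes that decode to nothing receive the degenerate
    box at [0]. Its volume is zero because there is at least one coordinate; an empty product would
    be [1]. *)
Lemma lebesgue_null_countable_cover A :
  (forall e : R, 0 < e -> exists (I : countType) (a b : I -> 'M[R]_(m, n)),
    [/\ forall k i j, a k i j <= b k i j,
        forall x, A x -> exists k, forall i j, a k i j <= x i j <= b k i j
      & forall s : seq I, uniq s -> \sum_(k <- s) box_vol (a k) (b k) <= e]) ->
  lebesgue_null A.
Proof.
move=> cover e /cover[I [a [b [ab cA sA]]]].
exists (fun k => oapp a 0 (pickle_inv k)), (fun k => oapp b 0 (pickle_inv k)).
split; first by move=> k i j; case: (pickle_inv k) => /=.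
split=> [x /cA[k xk]|N]; first by exists (pickle k); rewrite pickleK_inv.
have := sA (pmap pickle_inv (iota 0 N)) (pmap_uniq (@pickle_invK I) (iota_uniq 0 N)).
apply: le_trans; rewrite big_pmap [leRHS]big_mkcond /= -[N in iota 0 N]subn0.
rewrite -/(index_iota 0 N) big_mkord; apply: ler_sum => k _.
by case: (pickle_inv k) => //=; rewrite box_vol_point.
Qed.

Lemma lebesgue_null_bigcup (A : nat -> 'M[R]_(m, n) -> Prop) :
  (forall k, lebesgue_null (A k)) -> lebesgue_null (fun x => exists k, A k x).
Proof.
move=> nA; apply: lebesgue_null_countable_cover => e e0.
(* The [k]-th set gets volume budget [e / 2 ^+ k.+1], and the combined cover is indexed by pairs. *)
have e2 k : 0 < e / 2 ^+ k.+1 by rewrite divr_gt0 // exprn_gt0.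
have /choice[a /choice[b abP]] := fun k => nA k _ (e2 k).
exists (nat * nat)%type, (fun p => a p.1 p.2), (fun p => b p.1 p.2); split.
- by move=> [k l] i j; case: (abP k) => + _; apply.
- move=> x [k Akx]; have [_ [/(_ x Akx)[l xl] _]] := abP k.
  by exists (k, l).
move=> s us; have [N sN] : exists N, forall p, p \in s -> (p.1 < N)%N && (p.2 < N)%N.
  exists (\max_(p <- s) maxn p.1 p.2).+1 => p ps; rewrite !ltnS -geq_max.
  exact: (@leq_bigmax_seq _ _ xpredT (fun p => maxn p.1 p.2)).
(* A finite set of pairs sits in an [N] by [N] square, over which the sum can be iterated. *)
pose t := [seq (k, l) | k <- iota 0 N, l <- iota 0 N].
have ut : uniq t by apply: allpairs_uniq; rewrite ?iota_uniq // => -[? ?] [? ?].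
have st : {subset s <= t}.
  move=> [k l] /sN/andP[kN lN]; apply/allpairsP; exists (k, l).
  by split; rewrite ?mem_iota.
have vol_ge0 p : 0 <= box_vol (a p.1 p.2) (b p.1 p.2).
  by apply: box_vol_ge0; have [] := abP p.1.
apply: le_trans (ler_sum_subset vol_ge0 us ut st) _.
rewrite big_allpairs -[N in iota 0 N]subn0 -/(index_iota 0 N) big_mkord.
apply: le_trans (geometric_sum_le N (ltW e0)); apply: ler_sum => k _.
by rewrite big_mkord; have [_ [_]] := abP k; apply.
Qed.

Lemma lebesgue_nullU A B :
  lebesgue_null A -> lebesgue_null B -> lebesgue_null (fun x => A x \/ B x).
Proof.
move=> nA nB.
have /lebesgue_null_bigcup : forall k, lebesgue_null (if k == 0%N then A else B).
  by case.
by apply: lebesgue_null_sub => x [Ax|Bx]; [exists 0%N|exists 1%N].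
Qed.

Lemma lebesgue_null0 A : (forall x, ~ A x) -> lebesgue_null A.
Proof.
move=> A0 e e0; exists (fun=> 0), (fun=> 0); split=> //.
split=> [x /A0//|N]; rewrite big1 ?ltW // => k _; exact: box_vol_point.
Qed.

End NullSets.

(** Cut every coordinate except [(i0, j0)] into [N] intervals of length [h = 2M/N]. Over each cell
    the set has height at most [C * h] around a sample point, so [N^(d-1)] boxes of volume [2C h^d]
    suffice, with total [c / N]. *)
Lemma lebesgue_null_lipschitz_graph (R : realType) (m n : nat) (i0 : 'I_m)
    (j0 : 'I_n) (M C : R) (A : 'M[R]_(m, n) -> Prop) :
  0 < M -> 0 < C -> (forall x, A x -> forall i j, `|x i j| < M) ->
  (forall x y (h : R), A x -> A y -> 0 < h ->
     (forall i j, (i, j) != (i0, j0) -> `|x i j - y i j| <= h) ->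
     `|x i0 j0 - y i0 j0| <= C * h) ->
  lebesgue_null A.
Proof.
move=> M0 C0 AM Alip.
have m0 : (0 < m)%N by apply: leq_ltn_trans (ltn_ord i0).
have n0 : (0 < n)%N by apply: leq_ltn_trans (ltn_ord j0).
apply: lebesgue_null_countable_cover => // e e0.
pose k0 := (i0, j0); pose d := #|{: 'I_m * 'I_n}|.
have d0 : (0 < d)%N by apply/card_gt0P; exists k0.
pose c := 2 * C * (2 * M) ^+ d.
have c0 : 0 < c by rewrite !mulr_gt0 // exprn_gt0 // mulr_gt0.
pose N' := Num.bound (c / e); pose N := N'.+1.
have NR0 : 0 < N%:R :> R by rewrite ltr0n.
have Ne : c / N%:R <= e.
  rewrite ler_pdivrMr // mulrC -ler_pdivrMr //.
  by rewrite (le_trans (ltW (archi_boundP (ltW (divr_gt0 c0 e0))))) ?ler_nat ?leqnSn.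
pose h := 2 * M / N%:R; have h0 : 0 < h by rewrite !mulr_gt0 ?invr_gt0.
(* [inord] is only relied on for [|t| < M], where the truncation is below [N]. *)
pose cell (t : R) : 'I_N := inord (Num.trunc ((t + M) / h)).
have cellP t : `|t| < M -> (cell t)%:R * h - M <= t <= (cell t).+1%:R * h - M.
  rewrite ltr_norml => /andP[Mt tM].
  have q0 : 0 <= (t + M) / h by rewrite divr_ge0 ?ltW //; lra.
  have qN : (Num.trunc ((t + M) / h) < N)%N.
    rewrite truncn_lt_nat // ltr_pdivrMr // /h mulrC divfK ?gt_eqF //; lra.
  rewrite /cell inordK //; have /andP[l1 l2] := truncn_itv q0.
  rewrite ler_pdivlMr // in l1; rewrite ltr_pdivrMr // in l2.
  by apply/andP; split; lra.
(* Freezing the entry at [k0] leaves [N^(d-1)] possible keys, counted by [F]. *)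
pose key (x : 'M[R]_(m, n)) : {ffun 'I_m * 'I_n -> 'I_N} :=
  [ffun k => if k == k0 then ord0 else cell (x k.1 k.2)].
pose F := pffun_on (@ord0 N') (predC1 k0) (@predT 'I_N).
have keyF x : key x \in F.
  apply/pffun_onP; split=> //; apply/subsetP => k.
  by rewrite !inE ffunE; case: (k == k0); rewrite ?eqxx.
(* [w f] is a sample point of [A] in the cell [f], and arbitrary if [A] misses that cell. *)
have /choice[w wP] : forall f : {ffun 'I_m * 'I_n -> 'I_N}, exists y,
    forall x, A x -> key x = f -> A y /\ key y = f.
  move=> f.
  have [[x [Ax fx]]|nf] := EM (exists x, A x /\ key x = f).
    by exists x.
  by exists 0 => x Ax fx; case: nf; exists x.
(* Functions outside [F] are no keys; they get a degenerate box. *)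
pose a f : 'M[R]_(m, n) := if f \in F then \matrix_(i, j)
  (if (i, j) == k0 then w f i0 j0 - C * h else (f (i, j))%:R * h - M) else 0.
pose b f : 'M[R]_(m, n) := if f \in F then \matrix_(i, j)
  (if (i, j) == k0 then w f i0 j0 + C * h else (f (i, j)).+1%:R * h - M) else 0.
have ab f i j : a f i j <= b f i j.
  have Ch : 0 < C * h by rewrite mulr_gt0.
  rewrite /a /b; case: ifP => // _; rewrite !mxE.
  by case: ifP => _; [lra|rewrite -natr1 mulrDl mul1r; lra].
exists {ffun 'I_m * 'I_n -> 'I_N}, a, b; split=> //.
  move=> x Ax; exists (key x) => i j; rewrite /a /b keyF !mxE.
  have [Aw kw] := wP _ x Ax erefl.
  have [[-> ->]|ij] := eqVneq (i, j) k0; last first.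
    by rewrite ffunE (negPf ij); apply/cellP/AM.
  (* [x] and its sample point share a cell, so their other coordinates differ by at most [h]. *)
  rewrite -ler_distl; apply: Alip => // {}i {}j ij.
  have /ffunP/(_ (i, j)) := kw; rewrite !ffunE (negPf ij) /= => cij.
  have := cellP _ (AM _ Ax i j); have := cellP _ (AM _ Aw i j).
  rewrite cij -natr1 mulrDl mul1r ler_distl => /andP[? ?] /andP[? ?].
  by apply/andP; split; lra.
move=> s us; apply: le_trans Ne.
have vol f : box_vol (a f) (b f) = if f \in F then 2 * C * h ^+ d else 0.
  case: ifP => fF; last by rewrite /a /b fF box_vol_point.
  rewrite /box_vol pair_bigA /= (bigD1 k0) //= /a /b fF !mxE eqxx.
  rewrite (eq_bigr (fun=> h)) => [|[i j] /= ij].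
    rewrite prodr_const (eq_card (B := predC1 k0)) // cardC1 -/d.
    by rewrite -[d in RHS]prednK // exprS; ring.
  by rewrite !mxE (negPf ij) -natr1; ring.
apply: le_trans (ler_sum_subset _ us (enum_uniq _) _) _.
- by move=> f; apply: box_vol_ge0.
- by move=> f _; rewrite mem_enum.
rewrite big_enum /= (eq_bigr _ (fun f _ => vol f)) -big_mkcond /=.
rewrite sumr_const card_pffun_on cardC1 -/d card_ord -[leLHS]mulr_natl natrX.
rewrite -/N /c /h expr_div_n -[in N%:R ^+ d](prednK d0) exprS.
by rewrite le_eqVlt; apply/orP; left; apply/eqP; field; rewrite expf_neq0 ?gt_eqF.
Qed.

(** * Polynomial functions of a matrix *)

Section PolynomialFunctions.
Variables (R : realType) (m n : nat).
Implicit Types (x y z : 'M[R]_(m, n)) (f g : 'M[R]_(m, n) -> R) (M L h : R).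

(** The index is an upper bound for the degree, since constants are allowed at every [d].
    Multiplying by one coordinate at a time makes differentiation a structural recursion. *)
Inductive polyfun : nat -> ('M[R]_(m, n) -> R) -> Prop :=
| polyfun_cst d c : polyfun d (fun=> c)
| polyfun_coord d i j f : polyfun d f -> polyfun d.+1 (fun x => x i j * f x)
| polyfun_add d f g : polyfun d f -> polyfun d g -> polyfun d (fun x => f x + g x).

Definition mx_bounded M x := forall i j, `|x i j| <= M.

(* [g] is the partial derivative of [f] along the coordinate [(i0, j0)], with a
   remainder quadratic in that coordinate and Lipschitz in the others, uniformly
   on bounded sets. *)
Definition partial_derivative (i0 : 'I_m) (j0 : 'I_n) f g :=
  forall M, exists2 L, 0 <= L & forall x y h,
    mx_bounded M x -> mx_bounded M y -> 0 <= h ->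
    (forall i j, (i, j) != (i0, j0) -> `|y i j - x i j| <= h) ->
    `|f y - f x - g x * (y i0 j0 - x i0 j0)| <= L * ((y i0 j0 - x i0 j0) ^+ 2 + h).

Lemma polyfun_bounded d f M :
  polyfun d f -> exists2 B, 0 <= B & forall x, mx_bounded M x -> `|f x| <= B.
Proof.
elim=> [_ c|_ i j {}f _ [B B0 fB]|_ {}f g _ [B B0 fB] _ [B' B'0 gB']].
- by exists `|c|.
- exists (`|M| * B); first by rewrite mulr_ge0.
  move=> x xM; rewrite normrM ler_pM ?fB //.
  exact: le_trans (xM i j) (ler_norm M).
- exists (B + B'); first exact: addr_ge0.
  by move=> x xM; rewrite (le_trans (ler_normD _ _)) // lerD ?fB ?gB'.
Qed.

Lemma polyfun0_cst f : polyfun 0 f -> exists c, forall x, f x = c.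
Proof.
move En: 0%N => d pf; elim: pf En => {d f}[d c _|//|d f g _ IHf _ IHg /[dup]].
  by exists c.
by move=> /IHf[c fc] /IHg[c' gc']; exists (c + c') => x; rewrite fc gc'.
Qed.

(** This is the product rule. As [d.-1] truncates at [0], the last clause is what keeps
    [x i j * g x] within degree [d] when [d = 0]. *)
Lemma polyfun_partial_derivative i0 j0 d f : polyfun d f ->
  exists g, [/\ polyfun d.-1 g, partial_derivative i0 j0 f g
              & d = 0%N -> g = (fun=> 0)].
Proof.
elim=> {d f}[d c|d i j f pf [g [pg dg g0]]|d f f' _ [g [pg dg g0]] _ [g' [pg' dg' g'0]]].
- exists (fun=> 0); split=> //; first exact: polyfun_cst.
  move=> M; exists 0 => // x y h _ _ _ _.
  by rewrite subrr mul0r subrr normr0 mul0r.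
- exists (fun x => (if (i, j) == (i0, j0) then f x else 0) + x i j * g x); split=> //=.
    apply: polyfun_add; first by case: ((i, j) == (i0, j0)) => //; exact: polyfun_cst.
    case: d pf pg g0 => [|d] pf pg g0; last exact: polyfun_coord.
    rewrite (_ : (fun x => _) = (fun=> 0)); first exact: polyfun_cst.
    by apply/funext => x; rewrite g0 ?mulr0.
  move=> M; have [L L0 fL] := dg M.
  have [B B0 fB] := polyfun_bounded M pf.
  have [G G0 gG] := polyfun_bounded M pg.
  pose K := `|M|; have K0 : 0 <= K by exact: normr_ge0.
  (* With [D] the increment along [(i0, j0)] and [r] the remainder of [f], the summands bound in
     turn [x i j * r], [(y i j - x i j) * f y], [D * (g x * D)] and [D * r]. The second occurs only
     if [(i, j)] differs from [(i0, j0)], the last two only if they agree. *)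
  exists (K * L + B + G + L * (2 * K)); first by rewrite !addr_ge0 ?mulr_ge0.
  move=> x y h xM yM h0 xyh.
  have xK k l : `|x k l| <= K := le_trans (xM k l) (ler_norm M).
  have yK k l : `|y k l| <= K := le_trans (yM k l) (ler_norm M).
  have := fL x y h xM yM h0 xyh.
  set D := y i0 j0 - x i0 j0; set r := f y - f x - g x * D => rL.
  have DK : `|D| <= 2 * K.
    rewrite (le_trans (ler_normB _ _)) //; have := xK i0 j0; have := yK i0 j0; lra.
  have Lr0 := le_trans (normr_ge0 _) rL.
  have DD : `|D| ^+ 2 = D ^+ 2 by rewrite real_normK ?num_real.
  have xr : `|x i j * r| <= K * (L * (D ^+ 2 + h)) by rewrite normrM ler_pM.
  have D20 : 0 <= D ^+ 2 := sqr_ge0 D.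
  have BD : 0 <= B * D ^+ 2 by rewrite mulr_ge0.
  have GD : 0 <= G * D ^+ 2 by rewrite mulr_ge0.
  have LK : 0 <= L * (2 * K) by rewrite !mulr_ge0.
  have LKD := mulr_ge0 LK D20.
  have Bh : 0 <= B * h by rewrite mulr_ge0.
  have Gh : 0 <= G * h by rewrite mulr_ge0.
  have LKh := mulr_ge0 LK h0.
  have [[ei ej]|ij] := eqVneq (i, j) (i0, j0).
    have -> : y i j * f y - x i j * f x - (f x + x i j * g x) * D
            = x i j * r + (D * (g x * D) + D * r).
      by rewrite /r /D ei ej; ring.
    have gDD : `|D * (g x * D)| <= G * D ^+ 2.
      rewrite !normrM -DD expr2 mulrCA ler_pM ?mulr_ge0 // ?gG //.
    have Dr : `|D * r| <= 2 * K * (L * (D ^+ 2 + h)) by rewrite normrM ler_pM.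
    rewrite (le_trans (ler_normD _ _)) // (le_trans (lerD xr (ler_normD _ _))) //.
    rewrite (le_trans (lerD (lexx _) (lerD gDD Dr))) //; lra.
  have -> : y i j * f y - x i j * f x - (0 + x i j * g x) * D
          = x i j * r + (y i j - x i j) * f y by rewrite /r; ring.
  have yf : `|(y i j - x i j) * f y| <= h * B.
    by rewrite normrM ler_pM ?xyh ?fB.
  rewrite (le_trans (ler_normD _ _)) // (le_trans (lerD xr yf)) //; lra.
- exists (fun x => g x + g' x); split=> [|M|d0]; first exact: polyfun_add.
    have [L L0 fL] := dg M; have [L' L'0 fL'] := dg' M.
    exists (L + L') => [|x y h xM yM h0 xyh]; first exact: addr_ge0.
    rewrite [leRHS]mulrDl; apply: le_trans (lerD (fL _ _ _ xM yM h0 xyh) (fL' _ _ _ xM yM h0 xyh)).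
    apply: le_trans (ler_normD _ _); rewrite le_eqVlt; apply/orP; left.
    by apply/eqP; congr `|_|; ring.
  by apply/funext => x; rewrite g0 // g'0 // addr0.
Qed.

Lemma polyfun_le d e f : (d <= e)%N -> polyfun d f -> polyfun e f.
Proof.
move=> + pf; elim: pf e => {d f}[d c|d i j f _ IHf|d f g _ IHf _ IHg] e.
- by move=> _; exact: polyfun_cst.
- by case: e => // e de; apply/polyfun_coord/IHf.
- by move=> de; apply: polyfun_add; [exact: IHf|exact: IHg].
Qed.

Lemma polyfun_mul d e f g :
  polyfun d f -> polyfun e g -> polyfun (d + e) (fun x => f x * g x).
Proof.
move=> pf pg; elim: pf => {d f}[d c|d i j f _ IHf|d f f' _ IHf _ IHf'].
(* Only a constant left factor calls for an induction on [g]. *)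
- apply: (polyfun_le (leq_addl d e)).
  elim: pg => {e g}[e c'|e i j g _ IHg|e g g' _ IHg _ IHg'].
  + exact: polyfun_cst.
  + rewrite (_ : (fun x => _) = (fun x => x i j * (c * g x))); first exact: polyfun_coord.
    by apply/funext => x; rewrite mulrCA.
  + rewrite (_ : (fun x => _) = (fun x => c * g x + c * g' x)); first exact: polyfun_add.
    by apply/funext => x; rewrite mulrDr.
- rewrite (_ : (fun x => _) = (fun x => x i j * (f x * g x))); first exact: polyfun_coord.
  by apply/funext => x; rewrite mulrA.
- rewrite (_ : (fun x => _) = (fun x => f x * g x + f' x * g x)); first exact: polyfun_add.
  by apply/funext => x; rewrite mulrDl.
Qed.

Definition is_polyfun f := exists d, polyfun d f.

Lemma is_polyfun_cst c : is_polyfun (fun=> c).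
Proof. by exists 0%N; exact: polyfun_cst. Qed.

Lemma is_polyfun_coord i j : is_polyfun (fun x => x i j).
Proof.
exists 1%N; rewrite (_ : (fun x => _) = (fun x => x i j * 1)).
  exact/polyfun_coord/polyfun_cst.
by apply/funext => x; rewrite mulr1.
Qed.

Lemma is_polyfunD f g :
  is_polyfun f -> is_polyfun g -> is_polyfun (fun x => f x + g x).
Proof.
move=> [d pf] [e pg]; exists (maxn d e); apply: polyfun_add.
  exact: polyfun_le (leq_maxl d e) pf.
exact: polyfun_le (leq_maxr d e) pg.
Qed.

Lemma is_polyfunM f g :
  is_polyfun f -> is_polyfun g -> is_polyfun (fun x => f x * g x).
Proof. by move=> [d pf] [e pg]; exists (d + e)%N; exact: polyfun_mul. Qed.

Lemma is_polyfun_sum (I : Type) (s : seq I) (F : I -> 'M[R]_(m, n) -> R) :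
  (forall i, is_polyfun (F i)) -> is_polyfun (fun x => \sum_(i <- s) F i x).
Proof.
move=> pF; elim: s => [|i s IHs].
  under [fun x => _]funext do rewrite big_nil; exact: is_polyfun_cst.
under [fun x => _]funext do rewrite big_cons; exact: is_polyfunD.
Qed.

Lemma is_polyfun_prod (I : Type) (s : seq I) (F : I -> 'M[R]_(m, n) -> R) :
  (forall i, is_polyfun (F i)) -> is_polyfun (fun x => \prod_(i <- s) F i x).
Proof.
move=> pF; elim: s => [|i s IHs].
  under [fun x => _]funext do rewrite big_nil; exact: is_polyfun_cst.
under [fun x => _]funext do rewrite big_cons; exact: is_polyfunM.
Qed.

Lemma is_polyfun_det r (F : 'M[R]_(m, n) -> 'M[R]_r) :
  (forall i j, is_polyfun (fun x => F x i j)) -> is_polyfun (fun x => \det (F x)).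
Proof.
move=> pF; apply: is_polyfun_sum => s; apply: is_polyfunM; first exact: is_polyfun_cst.
exact: is_polyfun_prod.
Qed.

(** Divide the segment from [x] to [y] into [N + 1] equal steps. With [h = 0] the remainder is
    purely quadratic, so the total change of [f] is at most [L * D^2 / (N + 1)], which is
    arbitrarily small. *)
Lemma partial_derivative0_line i0 j0 f x y :
  partial_derivative i0 j0 f (fun=> 0) ->
  (forall i j, (i, j) != (i0, j0) -> y i j = x i j) -> f y = f x.
Proof.
move=> df xy; pose M := \sum_i \sum_j (`|x i j| + `|y i j|).
have xyM i j : `|x i j| + `|y i j| <= M.
  rewrite /M (bigD1 i) //= (bigD1 j) //= -addrA lerDl.
  by rewrite addr_ge0 ?sumr_ge0 // => *; rewrite ?sumr_ge0 // => *; rewrite addr_ge0.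
have [L L0 fL] := df M; set D := y i0 j0 - x i0 j0 in fL *.
pose z t : 'M[R]_(m, n) := \matrix_(i, j) ((1 - t) * x i j + t * y i j).
have zM t : 0 <= t <= 1 -> mx_bounded M (z t).
  move=> /andP[t0 t1] i j; rewrite mxE; apply: le_trans (xyM i j).
  have s0 : 0 <= 1 - t by lra.
  rewrite (le_trans (ler_normD _ _)) // !normrM (ger0_norm t0) (ger0_norm s0).
  by rewrite lerD // ler_piMl //; lra.
have step s t : 0 <= s <= 1 -> 0 <= t <= 1 ->
    `|f (z t) - f (z s)| <= L * ((t - s) * D) ^+ 2.
  move=> s01 t01; have := fL (z s) (z t) 0 (zM s s01) (zM t t01) (lexx 0).
  have -> : z t i0 j0 - z s i0 j0 = (t - s) * D by rewrite !mxE /D; ring.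
  rewrite mul0r subr0 addr0.
  apply=> i j ij; rewrite !mxE (xy _ _ ij) (_ : _ - _ = 0) ?normr0 //; ring.
have chain N k : (k <= N.+1)%N ->
    `|f (z (k%:R / N.+1%:R)) - f x| <= k%:R * (L * (D / N.+1%:R) ^+ 2).
  have N0 : 0 < N.+1%:R :> R by rewrite ltr0n.
  elim: k => [_|k IHk kN].
    rewrite mul0r (_ : z 0 = x) ?subrr ?normr0 ?mul0r //.
    by apply/matrixP => i j; rewrite mxE; ring.
  have k01 l : (l <= N.+1)%N -> 0 <= (l%:R / N.+1%:R : R) <= 1.
    by move=> lN; rewrite divr_ge0 ?ler0n //= ler_pdivrMr // mul1r ler_nat.
  have := step _ _ (k01 k (ltnW kN)) (k01 k.+1 kN).
  have -> : (k.+1%:R / N.+1%:R - k%:R / N.+1%:R) * D = D / N.+1%:R.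
    by rewrite -mulrBl -[k.+1%:R]natr1; ring.
  move=> fk; rewrite -[in leRHS]natr1 [leRHS]mulrDl mul1r [leRHS]addrC.
  apply: le_trans (lerD fk (IHk (ltnW kN))).
  by apply: le_trans (ler_normD _ _); rewrite addrA subrK.
have z1 : z 1 = y by apply/matrixP => i j; rewrite mxE; ring.
apply/eqP; rewrite -subr_eq0 -normr_le0; apply/negPn/negP; rewrite -ltNge => fxy.
have c0 : 0 <= L * D ^+ 2 / `|f y - f x|.
  by rewrite divr_ge0 // mulr_ge0 ?sqr_ge0.
have /= := archi_boundP c0; set N := Num.bound _ => Nc.
have N0 : 0 < N.+1%:R :> R by rewrite ltr0n.
have := chain N N.+1 (leqnn _); rewrite divff ?gt_eqF // z1.
rewrite (_ : _ * (_ * _) = L * D ^+ 2 / N.+1%:R); last by field; rewrite gt_eqF.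
rewrite ler_pdivlMr // leNgt => /negP; apply.
rewrite ltr_pdivrMr // in Nc; apply: lt_le_trans Nc _.
by rewrite mulrC ler_pM2l // ler_nat.
Qed.

(** Change [x] into [y] one coordinate at a time; [z s] has already switched the coordinates in
    [s]. *)
Lemma partial_derivatives0_cst f :
  (forall i j, partial_derivative i j f (fun=> 0)) -> forall x y, f x = f y.
Proof.
move=> df x y.
pose z (s : seq ('I_m * 'I_n)) : 'M[R]_(m, n) :=
  \matrix_(i, j) (if (i, j) \in s then y i j else x i j).
have zf s : f (z s) = f x.
  elim: s => [|[i0 j0] s <-].
    by congr f; apply/matrixP => i j; rewrite mxE.
  apply: (partial_derivative0_line (df i0 j0)) => i j ij.
  by rewrite !mxE in_cons (negPf ij).
by rewrite -(zf (enum {: 'I_m * 'I_n})); congr f; apply/matrixP => i j;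
   rewrite mxE mem_enum.
Qed.

(* Where the derivative does not vanish, the zero set is locally a Lipschitz
   graph over the remaining coordinates. *)
Lemma lebesgue_null_regular_zeros i0 j0 f g :
  partial_derivative i0 j0 f g -> lebesgue_null (fun x => f x = 0 /\ g x != 0).
Proof.
move=> df.
have m0 : (0 < m)%N by apply: leq_ltn_trans (ltn_ord i0).
have n0 : (0 < n)%N by apply: leq_ltn_trans (ltn_ord j0).
(* Countably many pieces, on each of which [x] is bounded and [g] is bounded away from zero. *)
pose A (k : nat) x := [/\ f x = 0, forall i j, `|x i j| < k.+1%:R
                        & 1 <= `|g x| * k.+1%:R].
apply: (@lebesgue_null_sub _ _ _ _ (fun x => exists k, A k x)) => [x [fx gx]|].
  pose S := \sum_i \sum_j `|x i j| + `|g x|^-1.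
  have S0 : 0 <= S.
    by rewrite addr_ge0 ?invr_ge0 // sumr_ge0 // => i _; rewrite sumr_ge0.
  have Sb : S < (Num.bound S).+1%:R.
    by rewrite (lt_trans (archi_boundP S0)) // ltr_nat.
  exists (Num.bound S); split=> // [i j|].
    apply: le_lt_trans Sb; rewrite /S (bigD1 i) //= (bigD1 j) //= -!addrA lerDl.
    rewrite !addr_ge0 ?invr_ge0 ?sumr_ge0 // => k _; exact: sumr_ge0.
  rewrite mulrC -ler_pdivrMr ?normr_gt0 // div1r; apply: le_trans (ltW Sb).
  by rewrite lerDr sumr_ge0 // => i _; rewrite sumr_ge0.
apply: lebesgue_null_bigcup => // k; set M : R := k.+1%:R in A *.
have M0 : 0 < M by rewrite ltr0n.
have [L' L'0 fL'] := df M; pose L := L' + 1.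
have L0 : 0 < L by rewrite ltr_wpDl.
(* Slabs of thickness [s] force [|D| <= s], hence [M * L * D^2 <= |D| / 2]: the quadratic error can
   be absorbed. Taking [L = L' + 1] ensures [L > 0]. *)
pose s := (2 * M * L)^-1; have s0 : 0 < s by rewrite invr_gt0 !mulr_gt0.
pose B (l : nat) x := A k x /\ l%:R * s <= x i0 j0 + M <= l.+1%:R * s.
apply: (@lebesgue_null_sub _ _ _ _ (fun x => exists l, B l x)) => [x Ax|].
  have [_ xM _] := Ax.
  have q0 : 0 <= (x i0 j0 + M) / s.
    by rewrite divr_ge0 ?ltW //; have := xM i0 j0; rewrite ltr_norml -/M; lra.
  exists (Num.trunc ((x i0 j0 + M) / s)); split=> //.
  have /andP[] := truncn_itv q0; rewrite ler_pdivlMr // ltr_pdivrMr // => -> /ltW.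
  by [].
apply: lebesgue_null_bigcup => // l.
apply: (lebesgue_null_lipschitz_graph (i0 := i0) (j0 := j0) (M := M) (C := 2 * M * L)).
- exact: M0.
- by rewrite !mulr_gt0.
- by move=> x [[_ xM _] _].
move=> x y h [[fx xM _] xs] [[fy yM gy] ys] h0 xyh.
have xM' : mx_bounded M x by move=> i j; exact/ltW/xM.
have yM' : mx_bounded M y by move=> i j; exact/ltW/yM.
(* Both values of [f] vanish, leaving [|g y| * |D| <= L * (D^2 + h)]. Multiplying by [M] and
   absorbing the quadratic term gives [|D| <= 2 * M * L * h]. *)
have := fL' y x h yM' xM' (ltW h0) xyh; rewrite fx fy subrr sub0r normrN normrM.
set D := x i0 j0 - y i0 j0; rewrite -/M in gy * => gD.
have Ds : `|D| <= s.
  by move: xs ys; rewrite -natr1 mulrDl mul1r ler_norml /D; lra.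
have DD : D ^+ 2 = `|D| ^+ 2 by rewrite real_normK ?num_real.
have D0 : 0 <= `|D| by [].
have gL : `|g y| * `|D| <= L * (`|D| ^+ 2 + h).
  rewrite -DD; apply: le_trans gD _; rewrite ler_wpM2r ?addr_ge0 ?sqr_ge0 ?ltW //.
  by rewrite ltrDl.
have D1 : `|D| <= `|g y| * `|D| * M by rewrite mulrAC ler_peMl.
have D2 : 2 * M * L * `|D| ^+ 2 <= `|D|.
  by rewrite expr2 mulrA ler_piMl // -ler_pdivlMl ?mulr_gt0 // mulr1.
have D3 : `|g y| * `|D| * M <= L * (`|D| ^+ 2 + h) * M by rewrite ler_wpM2r // ltW.
lra.
Qed.

Lemma lebesgue_null_polyfun_zeros f x0 : (0 < m)%N -> (0 < n)%N ->
  is_polyfun f -> f x0 != 0 -> lebesgue_null (fun x => f x = 0).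
Proof.
move=> m0 n0 [d]; elim: d f x0 => [|d IHd] f x0 pf fx0.
  apply: lebesgue_null0 => // x fx; have [c fc] := polyfun0_cst pf.
  by rewrite fc -(fc x) fx eqxx in fx0.
have [[i [j [g [z [pg dg gz]]]]]|nder] := EM (exists i j g z,
    [/\ polyfun d g, partial_derivative i j f g & g z != 0]).
  apply: lebesgue_null_sub (lebesgue_nullU m0 n0 (IHd g z pg gz)
                              (lebesgue_null_regular_zeros dg)) => x fx.
  by have [|] := eqVneq (g x) 0; [left|right].
(* All partial derivatives vanish identically, so [f] is a constant, nonzero because of [x0]. *)
have fcst : forall x y, f x = f y.
  apply: partial_derivatives0_cst => i j.
  have [g [pg dg _]] := polyfun_partial_derivative i j pf.
  rewrite (_ : (fun=> 0) = g) //; apply/funext => z; apply/esym/eqP/negPn/negP => gz.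
  by apply: nder; exists i, j, g, z.
by apply: lebesgue_null0 => // x fx; rewrite (fcst x0 x) fx eqxx in fx0.
Qed.

End PolynomialFunctions.

(** * Rank *)

(** Select a maximal free family of rows, then as many independent columns of the result. *)
Lemma nonzero_minor (F : fieldType) (m n : nat) (A : 'M[F]_(m, n)) :
  exists (f : 'I_(\rank A) -> 'I_m) (g : 'I_(\rank A) -> 'I_n),
    \det (mxsub f g A) != 0.
Proof.
have Bfull : row_full (rowsub (maxrankfun A) A)^T.
  by rewrite /row_full mxrank_tr; exact: maxrowsub_free.
exists (maxrankfun A), (fullrankfun Bfull).
have := fullrowsub_unit Bfull; rewrite unitmxE unitfE -det_tr.
by congr (\det _ != 0); apply/matrixP => i j; rewrite !mxE.
Qed.

Lemma leq_mxrank_minor (F : fieldType) (m n r : nat) (A : 'M[F]_(m, n))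
    (f : 'I_r -> 'I_m) (g : 'I_r -> 'I_n) :
  \det (mxsub f g A) != 0 -> (r <= \rank A)%N.
Proof.
rewrite -unitfE -unitmxE => /mxrank_unit <-.
have -> : mxsub f g A = rowsub f (rowsub g A^T)^T by apply/matrixP=> i j; rewrite !mxE.
apply: leq_trans (mxrankS (rowsub_sub _ _)) _.
by rewrite mxrank_tr -[leqRHS]mxrank_tr mxrankS ?rowsub_sub.
Qed.

(** Sorting the pairs by the larger index [j] gives [j.+1] choices for the smaller one. *)
Lemma card_leq_pairs (D : nat) :
  #|[pred p : 'I_D * 'I_D | (p.1 <= p.2)%N]| = ((D * D.+1) %/ 2)%N.
Proof.
rewrite -sum1_card -(pair_big_dep xpredT (fun i j : 'I_D => (i <= j)%N) (fun _ _ => 1%N)) /=.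
rewrite (exchange_big_dep xpredT) //= (eq_bigr (fun j : 'I_D => j.+1)); last first.
  move=> j _; rewrite -(big_ord_widen D (fun=> 1%N) (ltn_ord j)) sum1_card.
  exact: card_ord.
rewrite divn2 mulnC -(bin2 D.+1) -bin2_sum big_mkord big_ord_recl add0n.
exact: eq_bigr.
Qed.

(** By symmetry the rows at positions [(a, b)] and [(b, a)] coincide, so those with [a <= b] span
    the row space. *)
Lemma mxrank_symmetric_columns (F : fieldType) (D J : nat) (X : 'I_J -> 'M[F]_D) :
  (forall j, (X j)^T = X j) ->
  (\rank (\matrix_(r < D * D, j < J) mxvec (X j) 0%R r) <= (D * D.+1) %/ 2)%N.
Proof.
move=> Xsym; set A := (X in \rank X); rewrite -card_leq_pairs.
set P := [pred p : 'I_D * 'I_D | (p.1 <= p.2)%N].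
pose g (k : 'I_#|P|) := mxvec_index (enum_val k).1 (enum_val k).2.
have Prow (p : 'I_D * 'I_D) : p \in P -> (row (mxvec_index p.1 p.2) A <= rowsub g A)%MS.
  move=> pP; have -> : row (mxvec_index p.1 p.2) A = row (enum_rank_in pP p) (rowsub g A).
    by rewrite row_rowsub /g enum_rankK_in.
  exact: row_sub.
suff /mxrankS rA : (A <= rowsub g A)%MS by apply: leq_trans rA (rank_leq_row _).
apply/row_subP => r; case/mxvec_indexP: r => a b.
have [ab|/ltnW ba] := leqP a b; first exact: (Prow (a, b)).
rewrite (_ : row _ _ = row (mxvec_index b a) A); first exact: (Prow (b, a)).
by apply/rowP => j; rewrite !mxE !mxvecE -[in LHS]Xsym mxE.
Qed.

(** * The matrix [Mmat]: rank bound and polynomial entries *)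

Section FeatureMatrix.
Variables (R : realType) (D W V K : nat).
Implicit Types (s : sharp) (P : 'M[R]_(D, W + V * K)).

Lemma Nmat_sym s (Dm : 'M[R]_(W, V * K)) p : (@Nmat R D W V K s Dm p)^T = Nmat D Dm p.
Proof.
by case: s p => p /=; rewrite linearZ linearD /= !trmx_mul !trmxK addrC.
Qed.

Lemma mxrank_Mmat_le J s (theta : 'I_J -> _) P :
  (\rank (@Mmat R D W V K J s theta P) <= (D * D.+1) %/ 2)%N.
Proof.
have := mxrank_symmetric_columns
  (fun j => Nmat_sym ((lsubmx P)^T *m rsubmx P) (theta j)).
(* [vecc] is column-major and [mxvec] row-major; they agree on symmetric matrices. *)
by congr (\rank _ <= _)%N; apply/matrixP => r j; rewrite !mxE Nmat_sym.
Qed.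

Lemma is_polyfun_Gram i j :
  is_polyfun (fun P => ((lsubmx P)^T *m rsubmx P) i j).
Proof.
under [fun P => _]funext do rewrite mxE.
apply: is_polyfun_sum => k; under [fun P => _]funext do rewrite !mxE.
by apply: is_polyfunM; exact: is_polyfun_coord.
Qed.

Lemma is_polyfun_row_first i k :
  is_polyfun (fun P => row_first D ((lsubmx P)^T *m rsubmx P) i 0 k).
Proof.
under [fun P => _]funext do rewrite mxE.
(* The entry is either one of the Gram product or the padding constant [0]. *)
case: insubP => [c _ _|_]; [exact: is_polyfun_Gram|exact: is_polyfun_cst].
Qed.

Lemma is_polyfun_col_first l k :
  is_polyfun (fun P => col_first D ((lsubmx P)^T *m rsubmx P) l k 0).
Proof.
under [fun P => _]funext do rewrite mxE.
case: insubP => [c _ _|_]; [exact: is_polyfun_Gram|exact: is_polyfun_cst].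
Qed.

Lemma is_polyfun_Nmat s p a b :
  is_polyfun (fun P => @Nmat R D W V K s ((lsubmx P)^T *m rsubmx P) p a b).
Proof.
case: s p => p; under [fun P => _]funext do rewrite /= !mxE !big_ord1 ![_^T _ _]mxE.
- apply: is_polyfunM; first exact: is_polyfun_cst.
  by apply: is_polyfunD; apply: is_polyfunM; exact: is_polyfun_row_first.
- apply: is_polyfunM; first exact: is_polyfun_cst.
  by apply: is_polyfunD; apply: is_polyfunM; exact: is_polyfun_col_first.
Qed.

Lemma is_polyfun_Mmat J s (theta : 'I_J -> _) r j :
  is_polyfun (fun P => @Mmat R D W V K J s theta P r j).
Proof.
case/mxvec_indexP: r => a b.
under [fun P => _]funext do rewrite 2!mxE mxvecE mxE.
exact: is_polyfun_Nmat.
Qed.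

End FeatureMatrix.

Theorem theorem3 (R : realType) (D W V K J : nat)
  (hD : (0 < D)%N) (hW : (0 < W)%N) (hV : (0 < V)%N) (hK : (0 < K)%N)
  (s : sharp)
  (theta : 'I_J -> 'I_(sharp_bound s W V K) * 'I_(sharp_bound s W V K)) :
  (forall P : 'M[R]_(D, W + V * K),
      (\rank (@Mmat R D W V K J s theta P) < (D * D.+1) %/ 2)%N)
  \/
  ae_lebesgue (fun P : 'M[R]_(D, W + V * K) =>
      \rank (@Mmat R D W V K J s theta P) = ((D * D.+1) %/ 2)%N).
Proof.
have [|/existsNP[P0 /negP]] := EM (forall P : 'M[R]_(D, W + V * K),
    (\rank (@Mmat R D W V K J s theta P) < (D * D.+1) %/ 2)%N); first by left.
rewrite -leqNgt => rP0; right.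
have [f [g minor0]] := nonzero_minor (Mmat theta P0).
(* The rows and columns selected at [P0] stay fixed while [P] varies. The minor has order the rank
   at [P0], so where it is nonzero the rank is at least as large. *)
exists (fun P => \det (mxsub f g (Mmat theta P)) = 0); split.
  apply: (lebesgue_null_polyfun_zeros (x0 := P0)) => //; first by rewrite addn_gt0 hW.
  apply: is_polyfun_det => i j; under [fun P => _]funext do rewrite mxE.
  exact: is_polyfun_Mmat.
move=> P /eqP /leq_mxrank_minor rP; apply/eqP; rewrite eqn_leq mxrank_Mmat_le.
exact: leq_trans rP0 rP.
Qed.
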